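(* Let $N\ge 3$, let $\alpha,\beta\in\mathbb{R}$ with $\beta\neq 0$, and consider the ring system for amplitudes $a_i>0$ and phases $\phi_i$ (indices $i=1,\dots,N$ modulo $N$) $$\frac{da_i}{dt}=-\frac{a_i-1}{2}-\frac{\beta}{2}\big[a_{i+1}\sin(\phi_{i+1}-\phi_i)+a_{i-1}\sin(\phi_{i-1}-\phi_i)\big],$$ $$\frac{d\phi_i}{dt}=\alpha a_i^2+\frac{\beta}{2}\Big[\frac{a_{i+1}}{a_i}\cos(\phi_{i+1}-\phi_i)+\frac{a_{i-1}}{a_i}\cos(\phi_{i-1}-\phi_i)-2\Big].$$ Write $\Delta_i=\phi_{i+1}-\phi_i$ (modulo $2\pi$). Then: (i) A configuration with $a_i=1$ for all $i$ satisfies $\frac{da_i}{dt}=0$ and $\frac{d\phi_{i+1}}{dt}-\frac{d\phi_i}{dt}=0$ for all $i$ if and only if there is $\Delta$ such that, modulo $2\pi$, either $\Delta_i=\Delta$ for all $i$, or ($N$ is even and) every other phase difference equals $\Delta$ and the remaining ones equal $\pi-\Delta$. (ii) Configurations of the second type with $\Delta\not\equiv\pi-\Delta \pmod{2\pi}$ exist if and only if $N$ is a multiple of $4$. (iii) The configurations with all $\Delta_i$ equal to a common value $\Delta$ are exactly the $N$ configurations $\Delta=2\pi k/N$ with $k\in\{0,1,\dots,N-1\}$, and for each such $k$ the corresponding solution of the system is $$a_i(t)=1,\qquad \phi_i(t)=\phi_i(0)+\Big(\alpha+\beta\big(\cos\tfrac{2\pi k}{N}-1\big)\Big)t,\qquad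 \phi_{i+1}(0)-\phi_i(0)\equiv \tfrac{2\pi k}{N}\pmod{2\pi}.$$
   Context: All oscillator indices are taken modulo $N$. Since the oscillators form a ring, the sum of the $N$ phase differences $\Delta_i$ is an integer multiple of $2\pi$. The solution with common phase difference $2\pi k/N$ is called the rotating wave with wavenumber $k$. *)

(* Defs.v *)
From HB Require Import structures.
From mathcomp Require Import all_boot all_order all_algebra.
From mathcomp Require Import all_classical all_reals all_analysis.
Set Implicit Arguments.
Unset Strict Implicit.
Unset Printing Implicit Defensive.
Import Order.TTheory GRing.Theory Num.Theory.
Import numFieldNormedType.Exports.
Local Open Scope classical_set_scope.
Local Open Scope ring_scope.

(* Oscillators are indexed by 'I_N; [ordS] and [ord_pred] are the cyclic
   successor and predecessor, i.e. i + 1 and i - 1 modulo N.  Phases are real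
   representatives of angles, compared through [eq_mod2pi]. *)

Definition eq_mod2pi (R : realType) (x y : R) : Prop :=
  exists m : int, x - y = 2 * pi * m%:~R.

Definition amp_rhs (R : realType) (N : nat) (beta : R) (a phi : 'I_N -> R)
    (i : 'I_N) : R :=
  - ((a i - 1) / 2)
  - beta / 2 * (a (ordS i) * sin (phi (ordS i) - phi i)
                + a (ord_pred i) * sin (phi (ord_pred i) - phi i)).

Definition phase_rhs (R : realType) (N : nat) (alpha beta : R)
    (a phi : 'I_N -> R) (i : 'I_N) : R :=
  alpha * a i ^+ 2
  + beta / 2 * (a (ordS i) / a i * cos (phi (ordS i) - phi i)
                + a (ord_pred i) / a i * cos (phi (ord_pred i) - phi i) - 2).

Definition phase_diff (R : realType) (N : nat) (phi : 'I_N -> R) (i : 'I_N) : R :=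
  phi (ordS i) - phi i.

Definition is_solution_on (R : realType) (N : nat) (alpha beta : R) (D : set R)
    (a phi : R -> 'I_N -> R) : Prop :=
  forall (t : R) (i : 'I_N), D t ->
    [/\ 0 < a t i,
        is_derive t 1 (fun s => a s i) (amp_rhs beta (a t) (phi t) i) &
        is_derive t 1 (fun s => phi s i) (phase_rhs alpha beta (a t) (phi t) i)].

Definition uniform_config (R : realType) (N : nat) (phi : 'I_N -> R)
    (Delta : R) : Prop :=
  forall i : 'I_N, eq_mod2pi (phase_diff phi i) Delta.

(* The boolean [b] selects which parity class of indices carries Delta; the
   parity classes alternate around the ring because N is even. *)
Definition alternating_config (R : realType) (N : nat) (phi : 'I_N -> R)
    (Delta : R) : Prop :=
  ~~ odd N /\
  exists b : bool, forall i : 'I_N,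
    eq_mod2pi (phase_diff phi i) (if odd i == b then Delta else pi - Delta).

(* Main.v *)
Require Import Defs.
From HB Require Import structures.
From mathcomp Require Import all_boot all_order all_algebra.
From mathcomp Require Import all_classical all_reals all_analysis.
From mathcomp Require Import ring lra zify.
Set Implicit Arguments.
Unset Strict Implicit.
Unset Printing Implicit Defensive.
Import Order.TTheory GRing.Theory Num.Theory.
Import numFieldNormedType.Exports.
Local Open Scope classical_set_scope.
Local Open Scope ring_scope.

(** On the amplitude-one set the amplitude equations say that [sin Delta_i] is
    constant and the phase equations that [cos Delta_(i+2) = cos Delta_i];
    parities (ii) and wavenumbers (iii) are then read off the identity
    [sum_i Delta_i = 0] for real phase representatives. A solution starting on
    a rotating wave is compared with it on a compact time interval, where
    [a_i] and [1/a_i] are bounded: the vector field is then Lipschitz along the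
    rotating wave and Gronwall's inequality for the squared distance forces
    equality. *)


(** * Congruence modulo 2 pi, read through cosine and sine *)

Section Mod2pi.
Variable R : realType.
Implicit Types x y : R.

Lemma eq_mod2pi_sincos x y : eq_mod2pi x y -> cos x = cos y /\ sin x = sin y.
Proof.
suff nat_shift : forall (n : nat) (z : R), cos (z + 2 * pi * n%:R) = cos z
    /\ sin (z + 2 * pi * n%:R) = sin z.
  case=> m; case: (intP m) => [|n|n] e.
  - by have -> : x = y by apply/eqP; rewrite -subr_eq0 e mulr0.
  - by have -> : x = y + 2 * pi * n.+1%:R by rewrite -[_ * _]e addrC subrK.
  - have -> : y = x + 2 * pi * n.+1%:R.
      by rewrite -[LHS](subKr x) e mulrNz mulrN opprK.
    by case: (nat_shift n.+1 x).
move=> n z; have -> : 2 * pi * n%:R = (pi *+ 2) *+ n :> R.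
  by rewrite -[RHS]mulr_natr -[pi *+ 2]mulr_natl.
by split; [apply: (periodicn (@cosD2pi R)) | apply: (periodicn (@sinD2pi R))].
Qed.

Lemma cos_eq1 x : cos x = 1 -> exists m : int, x = 2 * pi * m%:~R.
Proof.
move=> c1; have pi0 := pi_gt0 R.
(* Rounding [x / (2 * pi)] to a nearest integer leaves a remainder [r] in [-pi, pi], so [|r|] lies
   in [0, pi], where [cos] is injective. *)
pose m := Num.floor (x / (2 * pi) + 2^-1).
exists m; pose r := x - 2 * pi * m%:~R.
have cr : cos `|r| = cos 0.
  rewrite cos_norm cos0 -c1.
  by apply: (proj1 (eq_mod2pi_sincos _)); exists (- m); rewrite /r mulrNz; ring.
have /andP[m1 m2] : m%:~R <= x / (2 * pi) + 2^-1 < (m + 1)%:~R.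
  exact: floor_itv.
have rpi : `|r| <= pi.
  have xE : x = x / (2 * pi) * (2 * pi) by field; lra.
  rewrite intrD in m2; rewrite /r ler_norml; apply/andP; split.
  - rewrite {1}xE; nra.
  - rewrite {1}xE; nra.
have : `|r| = 0.
  by apply: cos_inj cr; rewrite in_itv /= ?normr_ge0 ?lexx ?rpi ?ltW.
by move/eqP; rewrite normr_eq0 subr_eq0 => /eqP.
Qed.

(** Conversely, equal cosines and sines turn [cos (x - y)] into cos^2 + sin^2 = 1, and [cos_eq1]
    applies. All congruences of angles are handled through this criterion. *)
Lemma eq_mod2piP x y : eq_mod2pi x y <-> cos x = cos y /\ sin x = sin y.
Proof.
split=> [/eq_mod2pi_sincos //|[c s]].
by apply: cos_eq1; rewrite cosB c s -!expr2 cos2Dsin2.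
Qed.

Lemma cospiB x : cos (pi - x) = - cos x.
Proof. by rewrite cosB cospi sinpi mul0r addr0 mulN1r. Qed.

Lemma sinpiB x : sin (pi - x) = sin x.
Proof. by rewrite sinB cospi sinpi; ring. Qed.

End Mod2pi.

(** * Cyclic shifts, phase differences and alternating configurations *)

Section Ring.
Variables (R : realType) (N : nat).

Lemma val_iter_ordS n (i : 'I_N) : iter n (@ordS N) i = ((i + n) %% N)%N :> nat.
Proof.
elim: n => [|n IHn]; first by rewrite addn0 modn_small.
by rewrite iterS /= IHn -addn1 modnDml addn1 addnS.
Qed.

(** The wrap from [N - 1] to 0 subtracts the even number [N], so parity alternates there too. *)
Lemma odd_ordS (i : 'I_N) : ~~ odd N -> odd (ordS i) = ~~ odd i.
Proof.
move=> oN; rewrite /= -[RHS]/(odd i.+1) [in RHS](divn_eq i.+1 N).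
by rewrite oddD oddM (negbTE oN) andbF.
Qed.

Lemma ord_iterE (i0 i : 'I_N) : i0 = 0%N :> nat -> i = iter i (@ordS N) i0.
Proof. by move=> e; apply: ord_inj; rewrite val_iter_ordS e add0n modn_small. Qed.

Lemma ordS2_invariant (f : 'I_N -> R) (i0 : 'I_N) :
  (forall i, f (ordS (ordS i)) = f i) ->
  forall n, f (iter n (@ordS N) i0) = f (if odd n then ordS i0 else i0).
Proof.
move=> ff n; rewrite -{1}(odd_double_half n).
elim: n./2 => [|k IHk]; first by case: (odd n).
by rewrite doubleS !addnS !iterS ff.
Qed.

(** Phases are real representatives, so the sum telescopes around the ring to exactly 0; the winding
    is carried by the integers that witness each [eq_mod2pi]. *)
Lemma sum_phase_diff (phi : 'I_N -> R) : \sum_i phase_diff phi i = 0.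
Proof.
rewrite /phase_diff sumrB; apply/eqP; rewrite subr_eq0; apply/eqP.
by symmetry; rewrite (reindex (@ordS N)) //; apply: onW_bij; apply: ordS_bij.
Qed.

(** The coupling to [ord_pred i] is the sine of minus the preceding phase difference; for nonzero
    [beta], stationary amplitudes thus mean equal consecutive sines. *)
Lemma amp_rhs1 (beta : R) (a phi : 'I_N -> R) i : (forall j, a j = 1) ->
  amp_rhs beta a phi i =
  - (beta / 2) * (sin (phase_diff phi i) - sin (phase_diff phi (ord_pred i))).
Proof.
move=> a1; rewrite /amp_rhs /phase_diff !a1 ord_predK.
by rewrite -(opprB (phi i) (phi (ord_pred i))) sinN; ring.
Qed.

Lemma phase_rhs1 (alpha beta : R) (a phi : 'I_N -> R) i : (forall j, a j = 1) ->
  phase_rhs alpha beta a phi i =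
  alpha + beta / 2 *
    (cos (phase_diff phi i) + cos (phase_diff phi (ord_pred i)) - 2).
Proof.
move=> a1; rewrite /phase_rhs /phase_diff !a1 ord_predK.
by rewrite -(opprB (phi i) (phi (ord_pred i))) cosN; field.
Qed.

(** Adding the sum of the prescribed differences to its shift by one index pairs each [D] with a
    [pi - D], so twice that sum is [pi * N] whatever [D] is. Since the actual differences sum to 0,
    N = -4M with M the sum of the winding integers. *)
Lemma alternating_dvd4 (phi : 'I_N -> R) (D : R) :
  alternating_config phi D -> (4 %| N)%N.
Proof.
move=> [eN [b aD]]; have pi0 := pi_gt0 R.
have [m mE] := choice aD.
pose f (i : 'I_N) : R := if odd i == b then D else pi - D.
have sumf : (\sum_i f i) *+ 2 = pi * N%:R.
  rewrite mulr2n {1}(reindex (@ordS N)) /=; last first.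
    by apply: onW_bij; apply: ordS_bij.
  rewrite -big_split /= (eq_bigr (fun=> pi)) ?sumr_const ?card_ord ?mulr_natr //.
  by move=> i _; rewrite /f odd_ordS //; case: b {aD mE f} (odd i) => -[] /=; ring.
have : \sum_i (phase_diff phi i - f i) = 2 * pi * (\sum_i m i)%:~R.
  by rewrite (eq_bigr _ (fun i _ => mE i)) -mulr_sumr
      (big_morph _ (intrD R) (erefl _)).
rewrite sumrB sum_phase_diff sub0r => sE.
have : pi * (N%:Z + 4 * \sum_i m i)%:~R = 0 :> R.
  rewrite intrD intrM mulrDr -[_ * N%:~R]sumf.
  by rewrite -[\sum_i f i]opprK sE; ring.
move/eqP; rewrite mulf_eq0 gt_eqF //= intr_eq0 => /eqP.
set M := \sum_i m i => e; apply/dvdnP; exists `|M|%N; lia.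
Qed.

Lemma alternating_config_exists :
  (4 %| N)%N -> exists phi : 'I_N -> R, alternating_config phi 0.
Proof.
move=> /dvdnP[q NE].
(* These phases 0, 0, pi, pi, 2 pi, 2 pi, ... have difference 0 after an even index and pi after an
   odd one. *)
exists (fun i => pi * (i./2)%:R); split; first by rewrite NE oddM andbF.
exists false => i; rewrite /phase_diff.
have [iN|iN] := eqVneq i.+1 N.
  have -> : (ordS i : nat) = 0%N by rewrite /= iN modnn.
  have oi : odd i by lia.
  have hi : (i./2 = q.*2.-1)%N by lia.
  (* With N = 4q the closing difference is -(2q - 1) pi = pi - 2 pi q. *)
  rewrite oi /=; exists (- q%:Z).
  have q0 : (0 < q)%N by lia.
  rewrite hi.
  have -> : (q.*2.-1)%:R = q%:R *+ 2 - 1 :> R.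
    by rewrite -subn1 natrB ?double_gt0 // -mul2n natrM mulr_natl.
  by rewrite mulrNz -[q%:~R]/(q%:R); ring.
have -> : (ordS i : nat) = i.+1 by rewrite /= modn_small // ltn_neqAle iN ltn_ord.
exists 0; rewrite mulr0 -[i.+1./2]/(uphalf i) uphalf_half.
by case: (odd i) => /=; rewrite natrD; ring.
Qed.

Lemma not_eq_mod2pi0pi : ~ eq_mod2pi (0 : R) (pi - 0).
Proof. by move/eq_mod2piP => -[]; rewrite subr0 cos0 cospi; lra. Qed.

End Ring.

(** * Classification of phase-locked unit configurations, and wavenumbers *)

Section Phase_locked.
Variables (R : realType) (N : nat).
Hypothesis N_gt0 : (0 < N)%N.

Lemma phase_locked_unit_configP (alpha beta : R) (a phi : 'I_N -> R) :
  beta != 0 -> (forall i, a i = 1) ->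
  ((forall i, amp_rhs beta a phi i = 0) /\
   (forall i, phase_rhs alpha beta a phi (ordS i)
              - phase_rhs alpha beta a phi i = 0))
  <-> exists Delta : R,
        uniform_config phi Delta \/ alternating_config phi Delta.
Proof.
move=> beta0 a1; set d := phase_diff phi.
have -> : ((forall i, amp_rhs beta a phi i = 0) /\
   (forall i, phase_rhs alpha beta a phi (ordS i)
              - phase_rhs alpha beta a phi i = 0)) <->
   (forall i, sin (d (ordS i)) = sin (d i)) /\
   (forall i, cos (d (ordS (ordS i))) = cos (d i)).
  have b0 : beta / 2 != 0 by rewrite mulf_neq0 // invr_eq0.
  split=> -[sH cH]; split=> i.
  - have := sH (ordS i); rewrite amp_rhs1 // ordSK => /eqP.
    by rewrite mulf_eq0 oppr_eq0 (negbTE b0) subr_eq0 => /eqP.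
  (* Neighbouring phase equations share the middle cosine [y], which cancels in their difference. *)
  - have := cH (ordS i); rewrite !phase_rhs1 // !ordSK -/d.
    set x := cos _; set y := cos _; set z := cos _ => e.
    have /eqP : beta / 2 * (x - z) = 0 by rewrite -e; ring.
    by rewrite mulf_eq0 (negbTE b0) subr_eq0 => /eqP.
  - by rewrite amp_rhs1 // -/d -{1}(ord_predK i) sH subrr mulr0.
  - rewrite !phase_rhs1 // ordSK -/d -{1}(ord_predK i) cH; ring.
split=> [[sH cH]|[D [uD|[oN [b aD]]]]].
- pose i0 := Ordinal N_gt0.
  have sE i : sin (d i) = sin (d i0).
    rewrite (@ord_iterE _ i0 i) //; elim: {1}(i : nat) => //= n IHn.
    by rewrite sH.
  have cE := @ordS2_invariant R N (fun i => cos (d i)) i0 cH.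
  exists (d i0).
  (* For odd [N], one turn around the ring returns to [i0] after an odd number of steps, so both
     parity classes carry the same cosine. *)
  have [oN|eN] := boolP (odd N).
    left=> i; apply/eq_mod2piP; split=> //.
    have c01 : cos (d (ordS i0)) = cos (d i0).
      have := cE N; rewrite oN => <-; congr (cos (d _)).
      by apply: ord_inj; rewrite val_iter_ordS modnDr modn_small.
    by rewrite -/d (@ord_iterE _ i0 i) // cE; case: ifP.
  (* Equal sines leave the two cosines equal up to sign; the opposite sign is the one of
     [pi - d i0]. *)
  have : (cos (d (ordS i0)) == cos (d i0)) ||
      (cos (d (ordS i0)) == - cos (d i0)).
    by rewrite -eqf_sqr !cos2sin2 sE.
  case/orP => /eqP c01.
    left=> i; apply/eq_mod2piP; split=> //.
    by rewrite -/d (@ord_iterE _ i0 i) // cE; case: ifP.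
  right; split=> //; exists false => i; apply/eq_mod2piP; rewrite -/d sE.
  rewrite (@ord_iterE _ i0 i) // cE -(@ord_iterE _ i0 i) //.
  by case: (odd i) => /=; rewrite ?cospiB ?sinpiB.
- have uE i : cos (d i) = cos D /\ sin (d i) = sin D by apply/eq_mod2piP/uD.
  by split=> i; rewrite ?(uE _).1 ?(uE _).2.
- have aE i : cos (d i) = (if odd i == b then cos D else - cos D) /\
      sin (d i) = sin D.
    by have /eq_mod2piP := aD i; rewrite -/d; case: ifP; rewrite ?cospiB ?sinpiB.
  by split=> i; rewrite ?(aE _).1 ?(aE _).2 // !odd_ordS // negbK.
Qed.

(** Summing the congruences around the ring gives N D = 2 pi M. The remainder of [M] modulo [N] is
    the wavenumber, and the quotient is the multiple of 2 pi that is dropped. *)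
Lemma uniform_config_wavenumber (phi : 'I_N -> R) (D : R) :
  uniform_config phi D -> exists k : 'I_N, eq_mod2pi D (2 * pi * k%:R / N%:R).
Proof.
move=> /choice[m mE]; pose M := - \sum_i m i.
have NR : N%:R != 0 :> R by rewrite pnatr_eq0 -lt0n.
have DE : D = 2 * pi * M%:~R / N%:R.
  have : \sum_i (phase_diff phi i - D) = 2 * pi * (\sum_i m i)%:~R.
    by rewrite (eq_bigr _ (fun i _ => mE i)) -mulr_sumr
      (big_morph _ (intrD R) (erefl _)).
  rewrite sumrB sum_phase_diff sumr_const card_ord sub0r -[D *+ N]mulr_natr => e.
  by apply: (mulIf NR); rewrite mulfVK // /M mulrNz mulrN -e opprK.
have NZ : N%:Z != 0 by rewrite eqz_nat -lt0n.
have kN : (`|(M %% N)%Z| < N)%N.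
  by have := ltz_mod M NZ; have := modz_ge0 M NZ; lia.
exists (Ordinal kN) => /=; exists (M %/ N)%Z.
have -> : (`|(M %% N)%Z|%N)%:R = (M %% N)%Z%:~R :> R.
  by rewrite -[in RHS](gez0_abs (modz_ge0 M NZ)).
by rewrite DE {1}(divz_eq M N) intrD intrM -[(Posz N)%:~R]/(N%:R); field.
Qed.

Lemma wavenumber_uniform_config (k : 'I_N) (D : R) :
  eq_mod2pi D (2 * pi * k%:R / N%:R) ->
  exists phi : 'I_N -> R, uniform_config phi D.
Proof.
(* Linear phases have difference exactly [D] except on the closing edge, where it is D - N D and N D
   = 2 pi (k + N m). *)
move=> [m e]; exists (fun i => D * i%:R) => i; rewrite /phase_diff.
have NR : N%:R != 0 :> R by rewrite pnatr_eq0 -lt0n.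
have [iN|iN] := eqVneq i.+1 N.
  have -> : (ordS i : nat) = 0%N by rewrite /= iN modnn.
  exists (- (k%:Z + N%:Z * m)); rewrite mulrNz intrD intrM.
  have -> : D = 2 * pi * k%:R / N%:R + 2 * pi * m%:~R by rewrite -e; ring.
  have iE : i%:R + 1 = N%:R :> R by rewrite natr1 iN.
  rewrite -[(Posz N)%:~R]/(N%:R) -[(Posz k)%:~R]/(k%:R) -iE; field.
  by rewrite iE.
have -> : (ordS i : nat) = i.+1 by rewrite /= modn_small // ltn_neqAle iN ltn_ord.
by exists 0; rewrite -natr1; ring.
Qed.

(** The congruence says k - l = N m, while both indices lie in [0, N), which forces m = 0. *)
Lemma wavenumber_inj (k l : 'I_N) :
  eq_mod2pi (2 * pi * k%:R / N%:R) (2 * pi * l%:R / N%:R :> R) -> k = l.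
Proof.
move=> [m e]; have pi0 := pi_gt0 R.
have NR : N%:R != 0 :> R by rewrite pnatr_eq0 -lt0n.
have : 2 * pi * (k%:Z - l%:Z - N%:Z * m)%:~R = 0 :> R.
  rewrite !intrB intrM -[(Posz N)%:~R]/(N%:R) -[(Posz k)%:~R]/(k%:R).
  rewrite -[(Posz l)%:~R]/(l%:R).
  have -> : 2 * pi * (k%:R - l%:R - N%:R * m%:~R) =
    N%:R * (2 * pi * k%:R / N%:R - 2 * pi * l%:R / N%:R - 2 * pi * m%:~R) :> R.
    by field.
  by rewrite e subrr mulr0.
move/eqP; rewrite mulf_eq0 gt_eqF ?mulr_gt0 //= intr_eq0 => /eqP klm.
apply: val_inj => /=; have := ltn_ord k; have := ltn_ord l.
by have [m0|m0|m0] := ltrgtP m 0; nia.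
Qed.

End Phase_locked.

(** * Gronwall's inequality for a finite family of functions vanishing at time 0 *)

Section Gronwall.
Variables (R : realType) (I : finType).

Lemma is_derive_sum_fin (x : R -> I -> R) (dx : I -> R) (t : R) :
  (forall i, is_derive t 1 (x^~ i) (dx i)) ->
  is_derive t 1 (fun s => \sum_i x s i) (\sum_i dx i).
Proof.
move=> dxE.
have -> : (fun s => \sum_i x s i) = \sum_(k < #|I|) (x^~ (enum_val k)).
  by apply/funext => s; rewrite fct_sumE (reindex _ (onW_bij _ (enum_val_bij I))).
rewrite (reindex _ (onW_bij _ (enum_val_bij I))) /=.
exact: is_derive_sum.
Qed.

(** The energy [E], the sum of squares, satisfies E' <= L E, so [E] times exp(-L t) does not
    increase from its initial value 0; being nonnegative, [E] vanishes at [T]. *)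
Lemma gronwall_zero_right (x dx : R -> I -> R) (K T : R) : 0 <= T ->
  (forall t i, 0 <= t <= T -> is_derive t 1 (x^~ i) (dx t i)) ->
  (forall t i, 0 <= t <= T -> `|dx t i| <= K * \sum_j `|x t j|) ->
  (forall i, x 0 i = 0) -> forall i, x T i = 0.
Proof.
move=> T0 dxE dxK x0.
pose E t := \sum_i x t i ^+ 2.
pose dE t := \sum_i 2 * (x t i * dx t i).
have EE t : 0 <= t <= T -> is_derive t 1 E (dE t).
  move=> tT; apply: (@is_derive_sum_fin (fun t i => x t i ^+ 2)) => i.
  have := dxE t i tT => ?; apply: is_derive_eq.
  by rewrite /GRing.scale /=; ring.
pose L := 2 * `|K| * #|I|%:R.
have dEL t : 0 <= t <= T -> dE t <= L * E t.
  move=> tT; pose S := \sum_j `|x t j|.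
  (* Cauchy-Schwarz, obtained by expanding the square and bounding each product by half the sum of
     the two squares. *)
  have S2 : S * S <= #|I|%:R * E t.
    rewrite /S mulr_suml.
    have -> : #|I|%:R * E t =
        \sum_i \sum_j (`|x t i| ^+ 2 + `|x t j| ^+ 2) / 2.
      rewrite (eq_bigr (fun i => (#|I|%:R * x t i ^+ 2 + E t) / 2)); last first.
        move=> i _; rewrite -mulr_suml big_split /= sumr_const cardT -cardE.
        rewrite [in RHS]mulr_natl real_normK ?num_real //; congr ((_ + _) / _).
        by apply: eq_bigr => j _; rewrite real_normK ?num_real.
      rewrite -mulr_suml big_split /= -mulr_sumr sumr_const cardT -cardE.
      by rewrite -/(E t) -[E t *+ _]mulr_natl; field.
    apply: ler_sum => i _; rewrite mulr_sumr; apply: ler_sum => j _.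
    by have := sqr_ge0 (`|x t i| - `|x t j|); nra.
  have : dE t <= 2 * `|K| * (S * S).
    have S0 : 0 <= S by apply: sumr_ge0.
    have -> : 2 * `|K| * (S * S) = \sum_i 2 * (`|x t i| * (`|K| * S)).
      by rewrite -mulr_sumr -mulr_suml -/S; ring.
    apply: ler_sum => i _; rewrite ler_pM2l //.
    apply: (le_trans (ler_norm _)); rewrite normrM.
    apply: ler_wpM2l => //; apply: (le_trans (dxK t i tT)).
    by rewrite ler_wpM2r // ler_norm.
  move=> /le_trans; apply.
  by rewrite /L -!mulrA ler_pM2l // ler_wpM2l.
pose G t := E t * expR (- L * t).
have GE t : 0 <= t <= T ->
    is_derive t 1 G ((dE t - L * E t) * expR (- L * t)).
  move=> tT; have := EE t tT => ?; apply: is_derive_eq.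
  by rewrite /GRing.scale /=; ring.
have GT : G T <= G 0.
  apply: (@ler0_derive1_le_cc _ G 0 T); rewrite ?in_itv /= ?lexx ?T0 //.
  - move=> t; rewrite in_itv /= => /andP[t0 tT].
    by apply: ex_derive; apply: GE; rewrite !ltW.
  - move=> t; rewrite in_itv /= => /andP[t0 tT].
    have tT' : 0 <= t <= T by rewrite !ltW.
    rewrite derive1E (@derive_val _ _ _ _ _ _ _ (GE t tT')).
    by rewrite mulr_le0_ge0 ?expR_ge0 // subr_le0 dEL.
  - apply: derivable_within_continuous => t; rewrite in_itv /= => tT.
    by apply: ex_derive; apply: GE.
have E0 : E 0 = 0 by rewrite /E big1 // => i _; rewrite x0 expr0n.
have : E T <= 0.
  by move: GT; rewrite /G E0 mul0r pmulr_lle0 // expR_gt0.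
move=> ET i; have : x T i ^+ 2 = 0.
  apply/eqP; rewrite eq_le sqr_ge0 andbT; apply: le_trans ET.
  by rewrite /E (bigD1 i) //= lerDl sumr_ge0 // => j _; rewrite sqr_ge0.
by move/eqP; rewrite sqrf_eq0 => /eqP.
Qed.

(** Negative [T] is reduced to the forward case by reversing time, which flips the sign of the
    derivative and keeps the bound. *)
Lemma gronwall_zero (D : set R) (x dx : R -> I -> R) (K T : R) :
  (forall t, 0 <= t <= T \/ T <= t <= 0 -> D t) ->
  (forall t i, D t -> is_derive t 1 (x^~ i) (dx t i)) ->
  (forall t i, 0 <= t <= T \/ T <= t <= 0 ->
    `|dx t i| <= K * \sum_j `|x t j|) ->
  (forall i, x 0 i = 0) -> forall i, x T i = 0.
Proof.
move=> DT dxE dxK x0; have [T0|T0] := leP 0 T.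
  apply: (gronwall_zero_right T0) x0.
  - by move=> t i tT; apply: dxE; apply: DT; left.
  - by move=> t i tT; apply: dxK; left.
have T0' : 0 <= - T by lra.
move=> i; rewrite -[T]opprK.
apply: (@gronwall_zero_right (fun t => x (- t))
  (fun t i => - dx (- t) i) K (- T)) => //.
- move=> t {}i tT; have tT' : T <= - t <= 0 by lra.
  have := dxE (- t) i (DT _ (or_intror tT')) => ?.
  rewrite -mulrN1.
  exact: (@is_derive1_comp R (x^~ i) -%R).
- move=> t {}i tT; have tT' : T <= - t <= 0 by lra.
  by rewrite normrN; apply: dxK; right.
- by move=> {}i; rewrite oppr0.
Qed.

End Gronwall.

(** * Lipschitz estimates along a rotating wave, its uniqueness and existence *)

Section Rotating_wave.
Variables (R : realType) (N : nat) (alpha beta : R).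

Lemma sin_lipschitz (x y : R) : `|sin x - sin y| <= `|x - y|.
Proof.
wlog yx : x y / y <= x.
  by move=> H; have [/H //|/ltW/H] := leP y x; rewrite distrC (distrC y).
have [|c _ ->] := @MVT_segment R sin cos y x yx (fun t _ => is_derive_sin t).
  by apply: derivable_within_continuous => t _; apply: derivable_sin.
by rewrite normrM ler_piMl // cos_max.
Qed.

Lemma cos_lipschitz (x y : R) : `|cos x - cos y| <= `|x - y|.
Proof.
rewrite -!sinDpihalf (le_trans (sin_lipschitz _ _)) //.
by rewrite opprD addrACA subrr addr0.
Qed.

(** [S] stands for a bound on the deviation of every single amplitude and phase; a phase difference
    involves two phases, hence the [2 * S]. *)
Lemma ampsin_diff (a x x0 S : R) : `|a - 1| <= S -> `|x - x0| <= 2 * S ->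
  `|a * sin x - sin x0| <= 3 * S.
Proof.
move=> aS xS.
have -> : a * sin x - sin x0 = (a - 1) * sin x + (sin x - sin x0) by ring.
have h1 : `|(a - 1) * sin x| <= S.
  by rewrite normrM (le_trans _ aS) // ler_piMr // sin_max.
have h2 := le_trans (sin_lipschitz x x0) xS.
by apply: (le_trans (ler_normD _ _)); lra.
Qed.

(** Since a / b - 1 = ((a - 1) - (b - 1)) / b, the estimate rests on a bound for [b^-1]. *)
Lemma ratiocos_diff (a b x x0 S K : R) : 0 < b -> b^-1 <= K ->
  `|a - 1| <= S -> `|b - 1| <= S -> `|x - x0| <= 2 * S ->
  `|a / b * cos x - cos x0| <= 2 * (K + 1) * S.
Proof.
move=> b0 bK aS bS xS.
have -> : a / b * cos x - cos x0 =
    ((a - 1) - (b - 1)) * b^-1 * cos x + (cos x - cos x0).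
  by field; rewrite gt_eqF.
have h1 : `|((a - 1) - (b - 1)) * b^-1 * cos x| <= 2 * S * K.
  rewrite 2!normrM (le_trans (ler_piMr _ (cos_max x))) // ?mulr_ge0 //.
  apply: ler_pM => //; last by rewrite ger0_norm // invr_ge0 ltW.
  by apply: (le_trans (ler_normB _ _)); lra.
have h2 := le_trans (cos_lipschitz x x0) xS.
by apply: (le_trans (ler_normD _ _)); lra.
Qed.

(** On the wave the two coupling terms are [sin D] and [- sin D] and cancel. Off it each moves by at
    most 3 S, which the factor beta / 2 turns into 3 |beta| S in total. *)
Lemma amp_rhs_uniform_bound (a phi phi0 : 'I_N -> R) (D S : R) (i : 'I_N) :
  uniform_config phi0 D ->
  (forall j, `|a j - 1| <= S) -> (forall j, `|phi j - phi0 j| <= S) ->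
  `|amp_rhs beta a phi i| <= (1 + 3 * `|beta|) * S.
Proof.
move=> uD aS phiS.
have sE j : sin (phi0 (ordS j) - phi0 j) = sin D.
  by have /eq_mod2piP[] := uD j.
have dS j k : `|(phi j - phi k) - (phi0 j - phi0 k)| <= 2 * S.
  have -> : (phi j - phi k) - (phi0 j - phi0 k) =
    (phi j - phi0 j) - (phi k - phi0 k) by ring.
  by apply: (le_trans (ler_normB _ _)); have := phiS j; have := phiS k; lra.
have h1 := ampsin_diff (aS (ordS i)) (dS (ordS i) i).
have h2 := ampsin_diff (aS (ord_pred i)) (dS (ord_pred i) i).
have e2 : sin (phi0 (ord_pred i) - phi0 i) = - sin D.
  by rewrite -(sE (ord_pred i)) ord_predK -sinN opprB.
rewrite sE in h1; rewrite e2 opprK in h2.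
rewrite /amp_rhs.
set x := a (ordS i) * _ in h1 *; set y := a (ord_pred i) * _ in h2 *.
have -> : - ((a i - 1) / 2) - beta / 2 * (x + y) =
  - (2^-1 * (a i - 1)) - beta * (2^-1 * ((x - sin D) + (y + sin D))) by ring.
apply: (le_trans (ler_normB _ _)); rewrite normrN !normrM.
have := aS i; set u := `|a i - 1| => uS.
have h3 := ler_normD (x - sin D) (y + sin D).
have := normr_ge0 beta; set b := `|beta| => b0.
have n2 : `|2^-1| = 2^-1 :> R by rewrite ger0_norm // invr_ge0.
have u0 : 0 <= u by apply: normr_ge0.
rewrite n2; set z := `| _ + _| in h3 *.
have z6 : z <= 6 * S by lra.
by nra.
Qed.

(** The comparison value is the frequency of the wave. The [alpha] term uses a^2 - 1 = (a - 1)(a +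
    1); each of the two cosine terms moves by at most 2 (K + 1) S. *)
Lemma phase_rhs_uniform_bound (a phi phi0 : 'I_N -> R) (D S K : R) (i : 'I_N) :
  uniform_config phi0 D -> 0 < a i -> a i <= K -> (a i)^-1 <= K ->
  (forall j, `|a j - 1| <= S) -> (forall j, `|phi j - phi0 j| <= S) ->
  `|phase_rhs alpha beta a phi i - (alpha + beta * (cos D - 1))|
    <= ((`|alpha| + 2 * `|beta|) * (K + 1)) * S.
Proof.
move=> uD ai0 aK aVK aS phiS.
have cE j : cos (phi0 (ordS j) - phi0 j) = cos D.
  by have /eq_mod2piP[] := uD j.
have dS j k : `|(phi j - phi k) - (phi0 j - phi0 k)| <= 2 * S.
  have -> : (phi j - phi k) - (phi0 j - phi0 k) =
    (phi j - phi0 j) - (phi k - phi0 k) by ring.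
  by apply: (le_trans (ler_normB _ _)); have := phiS j; have := phiS k; lra.
have h1 := ratiocos_diff ai0 aVK (aS (ordS i)) (aS i) (dS (ordS i) i).
have h2 := ratiocos_diff ai0 aVK (aS (ord_pred i)) (aS i) (dS (ord_pred i) i).
have e2 : cos (phi0 (ord_pred i) - phi0 i) = cos D.
  by rewrite -(cE (ord_pred i)) ord_predK -cosN opprB.
rewrite cE in h1; rewrite e2 in h2.
rewrite /phase_rhs.
set x := a (ordS i) / _ * _ in h1 *; set y := a (ord_pred i) / _ * _ in h2 *.
have -> : alpha * a i ^+ 2 + beta / 2 * (x + y - 2)
    - (alpha + beta * (cos D - 1)) =
  alpha * ((a i - 1) * (a i + 1))
  + beta * (2^-1 * ((x - cos D) + (y - cos D))) by field.
apply: (le_trans (ler_normD _ _)); rewrite !normrM.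
have n2 : `|2^-1| = 2^-1 :> R by rewrite ger0_norm // invr_ge0.
rewrite n2 (ger0_norm (_ : 0 <= a i + 1)); last lra.
have h3 := ler_normD (x - cos D) (y - cos D).
set z := `|(x - _) + _| in h3 *.
have {h3} z1 : 2^-1 * z <= 2 * (K + 1) * S by lra.
have u1 : `|a i - 1| * (a i + 1) <= S * (K + 1).
  by apply: ler_pM => //; lra.
have v1 := ler_wpM2l (normr_ge0 alpha) u1.
have v2 := ler_wpM2l (normr_ge0 beta) z1.
by lra.
Qed.

(** The continuous function a + 1/a attains a maximum on the compact interval and, both terms being
    positive, bounds each of them. *)
Lemma solution_amp_bounded (D : set R) (a phi : R -> 'I_N -> R) (c d : R) :
  c <= d -> `[c, d]%classic `<=` D -> is_solution_on alpha beta D a phi ->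
  exists K, forall i t, c <= t <= d -> a t i <= K /\ (a t i)^-1 <= K.
Proof.
move=> cd cdD sol.
have /choice[K KE] i :
    exists K, forall t, c <= t <= d -> a t i + (a t i)^-1 <= K.
  have [|x _ xmax] := @EVT_max R (fun t => a t i + (a t i)^-1) c d cd.
    apply: derivable_within_continuous => t tcd.
    have [a0 da _] := sol t i (cdD _ tcd).
    have a1 : a t i != 0 by rewrite gt_eqF.
    by apply: derivableD; [|apply: derivableV => //]; apply: ex_derive.
  by exists (a x i + (a x i)^-1) => t tcd; apply: xmax; rewrite in_itv.
exists (\sum_i `|K i|) => i t tcd.
have [a0 _ _] : [/\ 0 < a t i,
        is_derive t 1 (fun s => a s i) (amp_rhs beta (a t) (phi t) i) &
        is_derive t 1 (fun s => phi s i) (phase_rhs alpha beta (a t) (phi t) i)].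
  by apply: sol; apply: cdD; rewrite /= in_itv.
have aV0 : 0 < (a t i)^-1 by rewrite invr_gt0.
have : K i <= \sum_i `|K i|.
  rewrite (bigD1 i) //= (le_trans (ler_norm _)) // lerDl.
  by apply: sumr_ge0.
by have := KE i t tcd; lra.
Qed.

(** Common angular frequency of the rotating wave with phase difference [D]. *)
Let Omega (D : R) : R := alpha + beta * (cos D - 1).

Lemma rotating_wave_unique (J : set R) (a phi : R -> 'I_N -> R) (D : R) :
  is_interval J -> J 0 -> is_solution_on alpha beta J a phi ->
  (forall i, a 0 i = 1) -> uniform_config (phi 0) D ->
  forall t i, J t -> a t i = 1 /\ phi t i = phi 0 i + Omega D * t.
Proof.
move=> itvJ J0 sol a01 uD T i JT.
have JT' t : 0 <= t <= T \/ T <= t <= 0 -> J t.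
  by case=> tT; [apply: (itvJ _ _ J0 JT)|apply: (itvJ _ _ JT J0)].
(* [c] and [d] are the ends of the segment between 0 and [T], for either sign of [T]. *)
pose c := Num.min 0 T; pose d := Num.max 0 T.
have cdP t : 0 <= t <= T \/ T <= t <= 0 <-> c <= t <= d.
  rewrite /c /d; have [T0|T0] := leP 0 T.
    by split=> [[|]|]; [|lra|left].
  by split=> [[|]|]; [lra| |right].
have cd : c <= d by rewrite /c /d ge_min !le_max lexx.
have [|K KE] := solution_amp_bounded cd _ sol.
  by move=> t; rewrite /= in_itv /= => /cdP/JT'.
(* Deviation from the rotating wave: amplitudes in the left summand, phases in the right one, so
   that one Gronwall argument treats both. *)
pose x t (k : 'I_N + 'I_N) : R := match k with
  | inl j => a t j - 1 | inr j => phi t j - (phi 0 j + Omega D * t) end.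
pose dx t (k : 'I_N + 'I_N) : R := match k with
  | inl j => amp_rhs beta (a t) (phi t) j
  | inr j => phase_rhs alpha beta (a t) (phi t) j - Omega D end.
have xT : forall k, x T k = 0.
  apply: (@gronwall_zero R _ J x dx
    ((1 + 3 * `|beta|) + (`|alpha| + 2 * `|beta|) * (K + 1)) T JT').
  - move=> t [j|j] Jt; have [_ da dphi] := sol t j Jt; apply: is_derive_eq.
      by rewrite subr0.
    by rewrite /GRing.scale /=; ring.
  - move=> t k tT; have tcd := (cdP t).1 tT.
    set S := \sum_j _.
    have xS j : `|x t j| <= S.
      by rewrite /S (bigD1 j) //= lerDl sumr_ge0.
    have S0 : 0 <= S by apply: sumr_ge0.
    (* All phases of the wave turn by the same angle, so its differences stay those of time 0. *)
    have uDt : uniform_config (fun j => phi 0 j + Omega D * t) D.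
      move=> j; rewrite /phase_diff opprD addrACA subrr addr0; exact: uD.
    pose idx := match k with inl j => j | inr j => j end.
    have [aK aVK] := KE idx t tcd.
    have [a0 _ _] := sol t idx (JT' _ tT).
    have K0 : 0 <= K + 1 by lra.
    have nb := normr_ge0 beta; have na := normr_ge0 alpha.
    have C1 : 0 <= (1 + 3 * `|beta|) * S by rewrite mulr_ge0 //; lra.
    have C2 : 0 <= (`|alpha| + 2 * `|beta|) * (K + 1) * S.
      by rewrite mulr_ge0 // mulr_ge0 //; lra.
    rewrite mulrDl; case: k @idx aK aVK a0 => j idx aK aVK a0 /=.
      have := amp_rhs_uniform_bound j uDt
        (fun j => xS (inl j)) (fun j => xS (inr j)).
      by lra.
    have := phase_rhs_uniform_bound uDt a0 aK aVK
      (fun j => xS (inl j)) (fun j => xS (inr j)).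
    by rewrite -/(Omega D); lra.
  - by case=> j /=; rewrite ?a01 ?mulr0 ?addr0 subrr.
split; apply/eqP; rewrite -subr_eq0; apply/eqP.
  exact: (xT (inl i)).
exact: (xT (inr i)).
Qed.

(** Openness of [J] makes the explicit formulas hold near each time, so the derivatives can be
    computed from them. *)
Lemma rotating_wave_solution (J : set R) (a phi : R -> 'I_N -> R) (D : R) :
  open J -> uniform_config (phi 0) D ->
  (forall t i, J t -> a t i = 1 /\ phi t i = phi 0 i + Omega D * t) ->
  is_solution_on alpha beta J a phi.
Proof.
move=> oJ uD sol t i Jt.
have a1 j : a t j = 1 by case: (sol t j Jt).
have nJ : \forall s \near t, J s by apply: open_nbhs_nbhs.
have uDt : uniform_config (phi t) D.
  move=> j; rewrite /phase_diff (sol t _ Jt).2 (sol t j Jt).2.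
  by rewrite opprD addrACA subrr addr0; apply: uD.
have cE j : cos (phase_diff (phi t) j) = cos D by have /eq_mod2piP[] := uDt j.
have sE j : sin (phase_diff (phi t) j) = sin D by have /eq_mod2piP[] := uDt j.
split; first by rewrite a1.
- rewrite amp_rhs1 // !sE subrr mulr0.
  apply: (@near_eq_is_derive R R R (fun=> 1)).
    by near=> s; symmetry; apply: (sol s i _).1; near: s.
- rewrite phase_rhs1 // !cE.
  apply: (@near_eq_is_derive R R R (fun s => phi 0 i + Omega D * s)).
  + by near=> s; symmetry; apply: (sol s i _).2; near: s.
  + apply: is_derive_eq; rewrite /GRing.scale /= /Omega; field.
Unshelve. all: by end_near. Qed.

End Rotating_wave.

(** * Assembly of statements (i), (ii) and (iii) *)

Theorem mainTheorem1 (R : realType) (N : nat) (alpha beta : R)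
    (hN : (3 <= N)%N) (hbeta : beta != 0) :
  (* (i) *)
  (forall a phi : 'I_N -> R, (forall i, a i = 1) ->
     ((forall i, amp_rhs beta a phi i = 0) /\
      (forall i, phase_rhs alpha beta a phi (ordS i)
                 - phase_rhs alpha beta a phi i = 0))
     <-> exists Delta : R,
           uniform_config phi Delta \/ alternating_config phi Delta) /\
  (* (ii) *)
  ((exists (a phi : 'I_N -> R) (Delta : R),
      [/\ forall i, a i = 1,
          alternating_config phi Delta &
          ~ eq_mod2pi Delta (pi - Delta)])
   <-> (4 %| N)%N) /\
  (* (iii) *)
  (forall Delta : R,
     (exists a phi : 'I_N -> R,
        (forall i, a i = 1) /\ uniform_config phi Delta)
     <-> exists k : 'I_N, eq_mod2pi Delta (2 * pi * k%:R / N%:R)) /\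
  (forall k l : 'I_N,
     eq_mod2pi (2 * pi * k%:R / N%:R) (2 * pi * l%:R / N%:R :> R) -> k = l) /\
  (forall (k : 'I_N) (D : set R) (a phi : R -> 'I_N -> R),
     open D -> is_interval D -> D 0 ->
     ([/\ is_solution_on alpha beta D a phi,
          forall i, a 0 i = 1 &
          uniform_config (phi 0) (2 * pi * k%:R / N%:R)]
      <->
      (forall (t : R) (i : 'I_N), D t ->
         a t i = 1 /\
         phi t i = phi 0 i
                   + (alpha + beta * (cos (2 * pi * k%:R / N%:R) - 1)) * t) /\
      uniform_config (phi 0) (2 * pi * k%:R / N%:R))).
Proof.
have N_gt0 : (0 < N)%N by apply: leq_trans hN.
split; first by move=> a phi a1; apply: phase_locked_unit_configP.
split.
  split=> [[a [phi [D [_ altD _]]]]|/alternating_config_exists].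
    exact: alternating_dvd4 altD.
  case/(_ R) => phi alt0.
  (* The alternating values 0 and pi are distinct modulo 2 pi. *)
  exists (fun=> 1), phi, 0; split=> //; exact: not_eq_mod2pi0pi.
split.
  move=> D; split=> [[a [phi [_ uD]]]|[k /wavenumber_uniform_config]].
    exact: uniform_config_wavenumber uD.
  by case=> // phi uD; exists (fun=> 1), phi.
split; first by move=> k l; apply: wavenumber_inj.
move=> k J a phi oJ itvJ J0; split=> [[sol a01 uD]|[sol uD]].
  by split=> // t i Jt; apply: rotating_wave_unique sol _ _ _ _ _.
split=> //.
  by apply: rotating_wave_solution uD _ => // t i Jt; apply: sol.
by move=> i; case: (sol 0 i J0).
Qed.
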